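(* Let $n\geq 1$ and let $\mathcal{N}:L_n([0,1])\to L_n([0,1])$ be a function. Then $\mathcal{N}$ is an $n$-dimensional strong fuzzy negation if and only if there exists a strong fuzzy negation $N:[0,1]\to[0,1]$ such that $\mathcal{N}=\widetilde{N}$.
   Context: $L_n([0,1])=\{(x_1,\ldots,x_n)\in[0,1]^n : x_1\leq\cdots\leq x_n\}$, with projections $\pi_i(x_1,\ldots,x_n)=x_i$ and the componentwise order. For $x\in[0,1]$, $/x/=(x,\ldots,x)$. A fuzzy negation is a function $N:[0,1]\to[0,1]$ with $N(0)=1$, $N(1)=0$ and $N(x)\geq N(y)$ whenever $x\leq y$; it is strong if $N(N(x))=x$ for all $x$. An $n$-dimensional fuzzy negation is a function $\mathcal{N}:L_n([0,1])\to L_n([0,1])$ with $\mathcal{N}(/0/)=/1/$, $\mathcal{N}(/1/)=/0/$ and $\mathcal{N}(\mathbf{x})\geq\mathcal{N}(\mathbf{y})$ whenever $\mathbf{x}\leq\mathbf{y}$; it is strong if $\mathcal{N}(\mathcal{N}(\mathbf{x}))=\mathbf{x}$ for all $\mathbf{x}$. For a fuzzy negation $N$, $\widetilde{N}(\mathbf{x})=(N(\pi_n(\mathbf{x})),N(\pi_{n-1}(\mathbf{x})),\ldots,N(\pi_1(\mathbf{x})))$. *)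

(* Defs.v *)
From HB Require Import structures.
From mathcomp Require Import all_boot all_order all_algebra.
From mathcomp Require Import interval_inference.
From mathcomp Require Import reals.

Set Implicit Arguments.
Unset Strict Implicit.
Unset Printing Implicit Defensive.

Import Order.TTheory GRing.Theory Num.Theory.
Local Open Scope ring_scope.

Record simplex (R : realType) (n : nat) := Simplex {
  coords :> n.-tuple {i01 R};
  coords_sorted : sorted <=%O coords }.

HB.instance Definition _ (R : realType) (n : nat) :=
  [isSub for @coords R n].

(* Coordinates are numbered from 0: pi_ i is the (i+1)-st projection. *)
Definition pi_ (R : realType) (n : nat) (i : 'I_n) (x : simplex R n) : {i01 R} :=
  tnth x i.

Definition simplex_le (R : realType) (n : nat) (x y : simplex R n) : Prop :=
  forall i : 'I_n, pi_ i x <= pi_ i y.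

Lemma diag_sorted (R : realType) (n : nat) (a : {i01 R}) :
  sorted <=%O [tuple a | i < n].
Proof.
apply: (@path_sorted _ _ a); apply/(pathP a) => i; rewrite size_tuple => ltin.
have nthE j : nth a [tuple a | _ < n] j = a.
  case: (ltnP j n) => [ltjn | lenj]; last by rewrite nth_default ?size_tuple.
  by rewrite -(tnth_nth a _ (Ordinal ltjn)) tnth_mktuple.
by case: i ltin => [|i] _ /=; rewrite !nthE.
Qed.

Definition diag (R : realType) (n : nat) (a : {i01 R}) : simplex R n :=
  Simplex (diag_sorted n a).

Definition fuzzy_negation (R : realType) (N : {i01 R} -> {i01 R}) : Prop :=
  [/\ N 0%:i01 = 1%:i01, N 1%:i01 = 0%:i01
    & forall x y : {i01 R}, x <= y -> N y <= N x].

Definition strong_fuzzy_negation (R : realType)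
    (N : {i01 R} -> {i01 R}) : Prop :=
  fuzzy_negation N /\ forall x : {i01 R}, N (N x) = x.

Definition nfuzzy_negation (R : realType) (n : nat)
    (NN : simplex R n -> simplex R n) : Prop :=
  [/\ NN (diag n 0%:i01) = diag n 1%:i01,
      NN (diag n 1%:i01) = diag n 0%:i01
    & forall x y : simplex R n, simplex_le x y -> simplex_le (NN y) (NN x)].

Definition strong_nfuzzy_negation (R : realType) (n : nat)
    (NN : simplex R n -> simplex R n) : Prop :=
  nfuzzy_negation NN /\ forall x : simplex R n, NN (NN x) = x.

Lemma pi_mono (R : realType) (n : nat) (x : simplex R n) (i j : 'I_n) :
  (i <= j)%N -> pi_ i x <= pi_ j x.
Proof.
move=> leij; rewrite /pi_ !(tnth_nth 0%:i01).
by apply: (sorted_leq_nth le_trans le_refl _ (coords_sorted x));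
  rewrite ?inE ?size_tuple.
Qed.

Lemma tilde_sorted (R : realType) (n : nat) (N : {i01 R} -> {i01 R})
    (hN : fuzzy_negation N) (x : simplex R n) :
  sorted <=%O [tuple N (pi_ (rev_ord i) x) | i < n].
Proof.
case: hN => _ _ antiN; apply/(sortedP 0%:i01) => i; rewrite size_tuple => ltin.
have ltin' := ltnW ltin.
rewrite -(tnth_nth _ _ (Ordinal ltin')) -(tnth_nth _ _ (Ordinal ltin)).
rewrite !tnth_mktuple; apply/antiN/pi_mono => /=.
by rewrite leq_sub2l.
Qed.

(* rev_ord i has value n - 1 - i, so the images of the coordinates of x appear
   in reverse order; hN is used only to see that they are then sorted. *)
Definition tilde (R : realType) (n : nat) (N : {i01 R} -> {i01 R})
    (hN : fuzzy_negation N) (x : simplex R n) : simplex R n :=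
  Simplex (tilde_sorted hN x).

(* Main.v *)
(* L_n([0,1]) is a lattice and a strong negation NN is an order-reversing
   involution of it, so NN exchanges meets and joins and preserves the elements
   that are both join- and meet-irreducible.  These are the diagonal elements
   /a/ and the 0/1-valued elements v_k = (0,...,0,1,...,1) with k zeros.

   A nonconstant v_k is incomparable to every /b/ with 0 < b < 1.  So if NN /a/
   were a nonconstant v_k, every /b/ with 0 < b < 1 would be sent to one of the
   finitely many v_j, which is absurd as NN is injective.  Hence NN /a/ = /N a/
   for a strong negation N, and NN reverses the finite chain of the v_k, that is
   NN v_k = v_(n-k).

   Finally a <= x_i iff the meet of v_(i-1) and /a/ lies below x, iff NN x lies
   below the join of v_(n-i+1) and /N a/, iff (NN x)_(n-i+1) <= N a. *)

Require Import Defs.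
From mathcomp Require Import all_boot all_order all_algebra.
From mathcomp Require boolp.
From mathcomp Require Import interval_inference.
From mathcomp Require Import reals.

Import Order.TTheory GRing.Theory Num.Theory.

Local Open Scope ring_scope.

(** * Bounds in the unit interval and equality of sorted tuples *)

Lemma i01_ge0 {R : realType} (a : {i01 R}) : 0%:i01 <= a.
Proof. by rewrite -num_le /= ge0. Qed.

Lemma i01_le1 {R : realType} (a : {i01 R}) : a <= 1%:i01.
Proof. by rewrite -num_le /= le1. Qed.

Lemma i01_le0 {R : realType} (a : {i01 R}) : a <= 0%:i01 -> a = 0%:i01.
Proof. by move=> a0; apply/le_anti; rewrite a0 i01_ge0. Qed.

Lemma i01_ge1 {R : realType} (a : {i01 R}) : 1%:i01 <= a -> a = 1%:i01.
Proof. by move=> a1; apply/le_anti; rewrite a1 i01_le1. Qed.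

Lemma i01_neq10 {R : realType} : 1%:i01 <> 0%:i01 :> {i01 R}.
Proof. by move/(congr1 (fun a : {i01 R} => a%:num))/eqP; rewrite /= oner_eq0. Qed.

Definition i01_exp {R : realType} (a : {i01 R}) (t : nat) : {i01 R} :=
  (a%:num ^+ t)%:i01.

Lemma simplex_ext {R : realType} {n : nat} (x y : simplex R n) :
  (forall i, pi_ i x = pi_ i y) -> x = y.
Proof. by move=> xy; apply/val_inj/eq_from_tnth. Qed.

Lemma simplex_le_anti {R : realType} {n : nat} (x y : simplex R n) :
  simplex_le x y -> simplex_le y x -> x = y.
Proof.
by move=> xy yx; apply: simplex_ext => i; apply/le_anti; rewrite xy yx.
Qed.

(** * Lattice operations and two-valued elements of $L_n([0,1])$ *)

Lemma mktuple_sorted {R : realType} {n : nat} (f : 'I_n -> {i01 R}) :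
  (forall i j : 'I_n, (i <= j)%N -> f i <= f j) ->
  sorted <=%O [tuple f i | i < n].
Proof.
move=> fmono; apply/(sortedP 0%:i01) => i; rewrite size_tuple => ltin.
rewrite -(tnth_nth _ _ (Ordinal (ltnW ltin))) -(tnth_nth _ _ (Ordinal ltin)).
by rewrite !tnth_mktuple; apply: fmono => /=.
Qed.

Lemma meet_mono {R : realType} {n : nat} (x y : simplex R n) (i j : 'I_n) :
  (i <= j)%N ->
  Order.min (pi_ i x) (pi_ i y) <= Order.min (pi_ j x) (pi_ j y).
Proof. by move=> ij; apply: le_min2; apply: pi_mono. Qed.

Definition meet {R : realType} {n : nat} (x y : simplex R n) : simplex R n :=
  Simplex (mktuple_sorted _ (meet_mono x y)).

Lemma join_mono {R : realType} {n : nat} (x y : simplex R n) (i j : 'I_n) :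
  (i <= j)%N ->
  Order.max (pi_ i x) (pi_ i y) <= Order.max (pi_ j x) (pi_ j y).
Proof. by move=> ij; apply: le_max2; apply: pi_mono. Qed.

Definition join {R : realType} {n : nat} (x y : simplex R n) : simplex R n :=
  Simplex (mktuple_sorted _ (join_mono x y)).

Lemma step_mono {R : realType} {n : nat} (k : nat) (a b : {i01 R})
    (i j : 'I_n) :
  (i <= j)%N ->
  (if (i < k)%N then Order.min a b else b) <=
  (if (j < k)%N then Order.min a b else b).
Proof.
move=> ij; case: (ltnP j k) => [jk|_]; first by rewrite (leq_ltn_trans ij jk).
by case: ifP => // _; rewrite ge_min lexx orbT.
Qed.

(* The minimum makes the tuple sorted for all a and b; only a <= b is used. *)
Definition step {R : realType} {n : nat} (k : nat) (a b : {i01 R}) :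
    simplex R n :=
  Simplex (mktuple_sorted _ (step_mono k a b)).

Lemma pi_meet {R : realType} {n : nat} (x y : simplex R n) (i : 'I_n) :
  pi_ i (meet x y) = Order.min (pi_ i x) (pi_ i y).
Proof. by rewrite /pi_ tnth_mktuple. Qed.

Lemma pi_join {R : realType} {n : nat} (x y : simplex R n) (i : 'I_n) :
  pi_ i (join x y) = Order.max (pi_ i x) (pi_ i y).
Proof. by rewrite /pi_ tnth_mktuple. Qed.

Lemma pi_diag {R : realType} {n : nat} (a : {i01 R}) (i : 'I_n) :
  pi_ i (diag n a) = a.
Proof. by rewrite /pi_ tnth_mktuple. Qed.

Lemma pi_tilde {R : realType} {n : nat} (N : {i01 R} -> {i01 R})
    (hN : fuzzy_negation N) (x : simplex R n) (i : 'I_n) :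
  pi_ i (tilde hN x) = N (pi_ (rev_ord i) x).
Proof. by rewrite /pi_ tnth_mktuple. Qed.

Lemma pi_step {R : realType} {n : nat} (k : nat) (a b : {i01 R}) (i : 'I_n) :
  a <= b -> pi_ i (step k a b) = if (i < k)%N then a else b.
Proof. by move=> ab; rewrite /pi_ tnth_mktuple min_l. Qed.

Definition pi_step0 {R : realType} {n : nat} (k : nat) (a : {i01 R})
    (i : 'I_n) := pi_step k 0%:i01 a i (i01_ge0 a).

Definition pi_step1 {R : realType} {n : nat} (k : nat) (a : {i01 R})
    (i : 'I_n) := pi_step k a 1%:i01 i (i01_le1 a).

Lemma diag_step0 {R : realType} {n : nat} (a : {i01 R}) :
  diag n a = step 0 0%:i01 a.
Proof. by apply: simplex_ext => i; rewrite pi_diag pi_step0. Qed.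

Lemma diag_step1 {R : realType} {n : nat} (a : {i01 R}) :
  diag n a = step n a 1%:i01.
Proof. by apply: simplex_ext => i; rewrite pi_diag pi_step1 ltn_ord. Qed.

(** * Join- and meet-irreducible elements *)

Definition join_irreducible {R : realType} {n : nat} (x : simplex R n) : Prop :=
  forall y z, x = join y z -> x = y \/ x = z.

Definition meet_irreducible {R : realType} {n : nat} (x : simplex R n) : Prop :=
  forall y z, x = meet y z -> x = y \/ x = z.

(** Coordinate [k] decides: there one of the two joinands reaches [a], and being sorted it stays
    above [a] at all later coordinates. *)
Lemma join_irreducible_step {R : realType} {n : nat} (k : nat) (a : {i01 R}) :
  join_irreducible (step k 0%:i01 a : simplex R n).
Proof.
move=> y z e; have pe j := esym (congr1 (pi_ j) e).
have dominates w : (forall j, pi_ j w <= pi_ j (step k 0%:i01 a)) ->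
    (forall j : 'I_n, ~~ (j < k)%N -> a <= pi_ j w) -> step k 0%:i01 a = w.
  move=> ub lb; apply: simplex_le_anti => // j; rewrite pi_step0.
  by case: ifPn => [_|/lb //]; apply: i01_ge0.
have uby j : pi_ j y <= pi_ j (step k 0%:i01 a).
  by rewrite -pe pi_join le_max lexx.
have ubz j : pi_ j z <= pi_ j (step k 0%:i01 a).
  by rewrite -pe pi_join le_max lexx orbT.
(* For [k >= n] the element is $/0/$, and the lower bound asked of [y] is vacuous. *)
case: (ltnP k n) => [kn|nk]; last first.
  left; apply: dominates => // j.
  by rewrite (leq_trans (ltn_ord j) nk).
have := pe (Ordinal kn); rewrite pi_join pi_step0 /= ltnn => ek.
have [ya|za] : a <= pi_ (Ordinal kn) y \/ a <= pi_ (Ordinal kn) z.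
  by apply/orP; rewrite -le_max ek.
- left; apply: dominates => // j; rewrite -leqNgt => kj.
  exact: le_trans ya (pi_mono _ _).
- right; apply: dominates => // j; rewrite -leqNgt => kj.
  exact: le_trans za (pi_mono _ _).
Qed.

(** Dually, the last coordinate with index below [k] decides; its index is [(minn k n).-1] because
    [k] may exceed [n]. *)
Lemma meet_irreducible_step {R : realType} {n : nat} (k : nat) (a : {i01 R}) :
  meet_irreducible (step k a 1%:i01 : simplex R n).
Proof.
move=> y z e; have pe j := esym (congr1 (pi_ j) e).
have dominated w : (forall j, pi_ j (step k a 1%:i01) <= pi_ j w) ->
    (forall j : 'I_n, (j < k)%N -> pi_ j w <= a) -> step k a 1%:i01 = w.
  move=> lb ub; apply: simplex_le_anti => // j; rewrite pi_step1.
  by case: ifPn => [/ub //|_]; apply: i01_le1.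
have lby j : pi_ j (step k a 1%:i01) <= pi_ j y.
  by rewrite -pe pi_meet ge_min lexx.
have lbz j : pi_ j (step k a 1%:i01) <= pi_ j z.
  by rewrite -pe pi_meet ge_min lexx orbT.
case: (posnP (minn k n)) => [kn0|kn].
  left; apply: dominated => // j jk; have: (j < minn k n)%N.
    by rewrite leq_min jk ltn_ord.
  by rewrite kn0.
have ltkn : ((minn k n).-1 < n)%N by rewrite prednK // geq_minr.
have ltkk : ((minn k n).-1 < k)%N by rewrite prednK // geq_minl.
have lek (j : 'I_n) : (j < k)%N -> (j <= (minn k n).-1)%N.
  by move=> jk; rewrite -ltnS prednK // leq_min jk ltn_ord.
have := pe (Ordinal ltkn); rewrite pi_meet pi_step1 /= ltkk => ek.
have [ya|za] : pi_ (Ordinal ltkn) y <= a \/ pi_ (Ordinal ltkn) z <= a.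
  by apply/orP; rewrite -ge_min ek.
- left; apply: dominated => // j /lek jk; apply: le_trans _ ya.
  exact: pi_mono.
- right; apply: dominated => // j /lek jk; apply: le_trans _ za.
  exact: pi_mono.
Qed.

(* x is the join of its truncation from above at x_i and of its restriction to
   the coordinates after i. *)
Lemma join_irreducible_pi {R : realType} {n : nat} (x : simplex R n)
    (i j : 'I_n) :
  join_irreducible x -> pi_ i x = 0%:i01 \/ pi_ j x <= pi_ i x.
Proof.
move=> xJ; have : x = join (meet x (diag n (pi_ i x)))
                         (meet x (step i.+1 0%:i01 1%:i01)).
  apply: simplex_ext => k.
  rewrite pi_join !pi_meet pi_diag pi_step0 ltnS.
  case: leqP => [ki|ik]; last by rewrite (min_l (i01_le1 _)) max_r ?ge_min ?lexx.
  by rewrite (min_r (i01_ge0 _)) (max_l (i01_ge0 _)) min_l ?pi_mono.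
case/xJ => ex; [right|left].
  by rewrite ex pi_meet pi_diag ge_min -ex lexx orbT.
by rewrite ex pi_meet pi_step0 ltnSn (min_r (i01_ge0 _)).
Qed.

(** Dually, [x] is the meet of its truncation from below at $x_i$ and of [x] with all coordinates
    from [i] on raised to 1. *)
Lemma meet_irreducible_pi {R : realType} {n : nat} (x : simplex R n)
    (i j : 'I_n) :
  meet_irreducible x -> pi_ i x = 1%:i01 \/ pi_ i x <= pi_ j x.
Proof.
move=> xM; have : x = meet (join x (diag n (pi_ i x)))
                         (join x (step i 0%:i01 1%:i01)).
  apply: simplex_ext => k.
  rewrite pi_meet !pi_join pi_diag pi_step0.
  case: ltnP => [ki|ik].
    by rewrite (max_l (i01_ge0 _)) min_r ?le_max ?lexx.
  by rewrite (max_r (i01_le1 _)) (min_l (i01_le1 _)) max_l ?pi_mono.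
case/xM => ex; [right|left].
  by rewrite [leRHS](congr1 (pi_ j) ex) pi_join pi_diag le_max lexx orbT.
by rewrite ex pi_join pi_step0 ltnn (max_r (i01_le1 _)).
Qed.

Lemma zero_one_step {R : realType} {n : nat} (x : simplex R n) :
  (forall i, pi_ i x = 0%:i01 \/ pi_ i x = 1%:i01) ->
  exists2 k, (k <= n)%N & x = step k 0%:i01 1%:i01.
Proof.
(* [k] is the position of the first nonzero coordinate, and [n] if there is none. *)
move=> x01; have [k kE] : exists k, k = find (predC1 0%:i01) x by eexists.
exists k; first by rewrite kE -[leqRHS](size_tuple x) find_size.
apply: simplex_ext => i; rewrite pi_step0.
have nthx j : pi_ j x = nth 0%:i01 x j by rewrite /pi_ (tnth_nth 0%:i01).
case: ltnP => [ik|ki].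
  rewrite nthx; apply/eqP/negbFE; rewrite kE in ik.
  exact: (before_find 0%:i01 ik).
have kn : (k < n)%N := leq_ltn_trans ki (ltn_ord i).
have xk : pi_ (Ordinal kn) x != 0%:i01.
  have hasx : has (predC1 0%:i01) x by rewrite has_find size_tuple -kE.
  by rewrite nthx /= kE; exact: (nth_find 0%:i01 hasx).
have [xk0|xk1] := x01 (Ordinal kn); first by rewrite xk0 eqxx in xk.
by apply: i01_ge1; rewrite -xk1; apply: pi_mono.
Qed.

(** If some coordinate is neither 0 nor 1, irreducibility bounds the last coordinate by it and it by
    the first one, so the sorted tuple is constant. *)
Lemma irreducible_cases {R : realType} {n : nat} (x : simplex R n.+1) :
  join_irreducible x -> meet_irreducible x ->
  (exists a, x = diag n.+1 a) \/
  exists2 k, (k <= n.+1)%N & x = step k 0%:i01 1%:i01.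
Proof.
move=> xJ xM; case: (leP (pi_ ord_max x) (pi_ ord0 x)) => [le_max_0|lt_0_max].
  left; exists (pi_ ord0 x); apply: simplex_ext => i; rewrite pi_diag.
  apply/le_anti; rewrite [X in _ && X]pi_mono // andbT.
  by apply: le_trans le_max_0; apply: pi_mono; rewrite -ltnS.
right; apply: zero_one_step => i.
have [|le_max_i] := join_irreducible_pi x i ord_max xJ; first by left.
have [|le_i_0] := meet_irreducible_pi x i ord0 xM; first by right.
by have := lt_le_trans lt_0_max (le_trans le_max_i le_i_0); rewrite ltxx.
Qed.

(** Each step loses at least 1: counting up from 0 bounds [j k] above by [n - k], counting down from
    [n] bounds it below. *)
Lemma decreasing_subn (n : nat) (j : nat -> nat) :
  (forall k, (k <= n)%N -> (j k <= n)%N) ->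
  (forall k, (k < n)%N -> (j k.+1 < j k)%N) ->
  forall k, (k <= n)%N -> j k = (n - k)%N.
Proof.
move=> jn jdec.
have ub k : (k <= n)%N -> (j k + k <= n)%N.
  elim: k => [|k IH] kn; first by rewrite addn0 jn.
  by apply: leq_trans (IH (ltnW kn)); rewrite addnS -addSn leq_add2r jdec.
have lb k : (k <= n)%N -> (k <= j (n - k))%N.
  elim: k => // k IH kn; apply: leq_ltn_trans (IH (ltnW kn)) _.
  have := jdec (n - k.+1)%N; rewrite subnSK //; apply.
  exact: leq_subr.
move=> k kn; apply/eqP; rewrite eqn_leq leq_subRL // addnC ub //=.
by rewrite -{2}(subKn kn) lb // leq_subr.
Qed.

(** * A strong negation as an order-reversing involution of the lattice *)

Section StrongNegation.

Variables (R : realType) (m : nat).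
Let n := m.+1.
Variable NN : simplex R n -> simplex R n.
Hypothesis NN_strong : strong_nfuzzy_negation NN.

Local Notation v k := (step k 0%:i01 1%:i01 : simplex R n).

Lemma NNK (x : simplex R n) : NN (NN x) = x.
Proof. exact: (proj2 NN_strong). Qed.

Lemma NN_anti (x y : simplex R n) :
  simplex_le x y -> simplex_le (NN y) (NN x).
Proof. by case: NN_strong => -[N0 N1 +] _; apply. Qed.

Lemma NN_le (x y : simplex R n) :
  simplex_le (NN y) (NN x) -> simplex_le x y.
Proof. by move/NN_anti; rewrite !NNK. Qed.

Lemma NN_meet (x y : simplex R n) : NN (meet x y) = join (NN x) (NN y).
Proof.
have lex : simplex_le (meet x y) x by move=> i; rewrite pi_meet ge_min lexx.
have ley : simplex_le (meet x y) y.
  by move=> i; rewrite pi_meet ge_min lexx orbT.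
apply: simplex_le_anti; last first.
  by move=> i; rewrite pi_join ge_max (NN_anti _ _ lex) (NN_anti _ _ ley).
apply: NN_le; rewrite NNK => i; rewrite pi_meet le_min.
have lx : simplex_le (NN x) (join (NN x) (NN y)).
  by move=> j; rewrite pi_join le_max lexx.
have ly : simplex_le (NN y) (join (NN x) (NN y)).
  by move=> j; rewrite pi_join le_max lexx orbT.
have := NN_anti _ _ lx i; have := NN_anti _ _ ly i.
by rewrite !NNK => -> ->.
Qed.

Lemma NN_join (x y : simplex R n) : NN (join x y) = meet (NN x) (NN y).
Proof. by rewrite -[RHS]NNK NN_meet !NNK. Qed.

Lemma NN_join_irreducible (x : simplex R n) :
  meet_irreducible x -> join_irreducible (NN x).
Proof.
move=> xM y z /(congr1 NN); rewrite NNK NN_join => /xM.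
by case=> ->; rewrite NNK; [left|right].
Qed.

Lemma NN_meet_irreducible (x : simplex R n) :
  join_irreducible x -> meet_irreducible (NN x).
Proof.
move=> xJ y z /(congr1 NN); rewrite NNK NN_meet => /xJ.
by case=> ->; rewrite NNK; [left|right].
Qed.

Lemma NN_diag_cases (a : {i01 R}) :
  (exists b, NN (diag n a) = diag n b) \/
  exists2 k, (k <= n)%N & NN (diag n a) = v k.
Proof.
apply: irreducible_cases.
  by apply: NN_join_irreducible; rewrite diag_step1; apply: meet_irreducible_step.
by apply: NN_meet_irreducible; rewrite diag_step0; apply: join_irreducible_step.
Qed.

Lemma NN_step_cases (k : nat) :
  (exists b, NN (v k) = diag n b) \/
  exists2 j, (j <= n)%N & NN (v k) = v j.
Proof.
apply: irreducible_cases.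
  exact: NN_join_irreducible (meet_irreducible_step _ _).
exact: NN_meet_irreducible (join_irreducible_step _ _).
Qed.

(** * Images of the diagonal elements *)

Lemma diag0_step : diag n 0%:i01 = v n.
Proof. exact: diag_step1. Qed.

Lemma diag1_step : diag n 1%:i01 = v 0.
Proof. exact: diag_step0. Qed.

Lemma NN_diag0 : NN (diag n 0%:i01) = diag n 1%:i01.
Proof. by case: NN_strong => -[]. Qed.

Lemma NN_diag1 : NN (diag n 1%:i01) = diag n 0%:i01.
Proof. by case: NN_strong => -[]. Qed.

Lemma diag_inj (a b : {i01 R}) : diag n a = diag n b -> a = b.
Proof. by move/(congr1 (pi_ ord0)); rewrite !pi_diag. Qed.

Lemma diag_step_comparable (b : {i01 R}) (k : nat) :
  (0 < k)%N -> (k < n)%N ->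
  simplex_le (diag n b) (v k) \/ simplex_le (v k) (diag n b) ->
  b = 0%:i01 \/ b = 1%:i01.
Proof.
move=> k0 kn [/(_ ord0)|/(_ ord_max)]; rewrite pi_diag pi_step0 /=.
  by rewrite k0 => /i01_le0; left.
by rewrite ltnNge -ltnS kn => /i01_ge1; right.
Qed.

(** The diagonal is a chain, so the images of its elements are comparable with [v k]; an image that
    is itself diagonal is then $/0/$ or $/1/$, that is [v n] or [v 0]. *)
Lemma NN_diag_of_step (a : {i01 R}) (k : nat) :
  (0 < k)%N -> (k < n)%N -> NN (diag n a) = v k ->
  forall b, exists2 j, (j <= n)%N & NN (diag n b) = v j.
Proof.
move=> k0 kn ak b; have [[c bc]|//] := NN_diag_cases b.
have [c0|c1] : c = 0%:i01 \/ c = 1%:i01.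
- apply: diag_step_comparable k0 kn _; rewrite -ak -bc.
  case/orP: (le_total a b) => [ab|ba]; [left|right];
    by apply: NN_anti => i; rewrite !pi_diag.
- by exists n => //; rewrite bc c0 diag0_step.
- by exists 0%N => //; rewrite bc c1 diag1_step.
Qed.

(** Any coordinate would do, since the image turns out to be constant. *)
Definition diag_neg (a : {i01 R}) : {i01 R} := pi_ ord0 (NN (diag n a)).

Lemma NN_diag (a : {i01 R}) : NN (diag n a) = diag n (diag_neg a).
Proof.
rewrite /diag_neg.
have [[b ->]|[k kn ak]] := NN_diag_cases a; first by rewrite pi_diag.
case: (posnP k) => [k0|k0]; first by rewrite ak k0 -diag1_step pi_diag.
have [{}kn|nk] := ltnP k n; last first.
  have -> : NN (diag n a) = v n.
    by rewrite ak; congr (v _); apply/eqP; rewrite eqn_leq kn.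
  by rewrite -diag0_step pi_diag.
have to_step := NN_diag_of_step a k k0 kn ak.
have a0 : a != 0%:i01.
  apply/eqP => a0; have := congr1 (pi_ ord0) ak.
  by rewrite a0 NN_diag0 pi_diag pi_step0 k0 => /i01_neq10.
have a1 : a != 1%:i01.
  apply/eqP => a1; have := congr1 (pi_ ord_max) ak.
  rewrite a1 NN_diag1 pi_diag pi_step0 /= ltnNge -ltnS kn.
  by move/esym/i01_neq10.
(* Pigeonhole: since $0 < a < 1$, these [n + 2] powers of [a] are distinct, but their diagonal
   elements would be sent injectively to the [n + 1] elements [v 0], ..., [v n]. *)
pose c (t : 'I_n.+2) := i01_exp a t.
have c_inj : injective c.
  move=> s t /(congr1 (fun b : {i01 R} => b%:num)) /= e; apply/val_inj.
  have a_gt0 : 0 < a%:num by rewrite lt_neqAle ge0 eq_sym andbT; exact: a0.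
  exact: (ieexprIn a_gt0 a1 e).
have /boolp.choice [j jE] t : exists j : 'I_n.+1, NN (diag n (c t)) = v j.
  have [j jn e] := to_step (c t).
  by exists (Ordinal (jn : (j < n.+1)%N)); rewrite e.
have /leq_card : injective j.
  by move=> s t e; apply/c_inj/diag_inj; rewrite -[LHS]NNK -[RHS]NNK !jE e.
by rewrite !card_ord ltnn.
Qed.

Lemma diag_neg_strong : strong_fuzzy_negation diag_neg.
Proof.
split; first split.
- by rewrite /diag_neg NN_diag0 pi_diag.
- by rewrite /diag_neg NN_diag1 pi_diag.
- by move=> a b ab; apply: NN_anti => i; rewrite !pi_diag.
- by move=> a; apply: diag_inj; rewrite -!NN_diag NNK.
Qed.

(** * Images of the 0/1-valued elements *)

Lemma step_le (j k : nat) : (k <= n)%N -> simplex_le (v j) (v k) -> (k <= j)%N.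
Proof.
move=> kn jk; rewrite leqNgt; apply/negP => ltjk.
have := jk (Ordinal (leq_trans ltjk kn)); rewrite !pi_step0 /= ltnn ltjk.
by move/i01_le0/i01_neq10.
Qed.

Lemma NN_step_step (k : nat) :
  (k <= n)%N -> exists2 j, (j <= n)%N & NN (v k) = v j.
Proof.
move=> kn; have [[b kb]|//] := NN_step_cases k.
(* The involution makes [v k] itself diagonal, which forces [k = 0] or [k = n]. *)
have e : v k = diag n (diag_neg b) by rewrite -NN_diag -kb NNK.
case: (posnP k) => [k0|k0].
  by exists n => //; rewrite k0 -diag1_step NN_diag1 diag0_step.
case: (ltnP k n) => [{}kn|nk].
  have := congr1 (pi_ ord0) e; have := congr1 (pi_ ord_max) e.
  rewrite !pi_diag !pi_step0 k0 /= ltnNge -ltnS kn /= => <-.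
  by move/esym/i01_neq10.
have -> : k = n by apply/eqP; rewrite eqn_leq kn.
by exists 0%N => //; rewrite -diag0_step NN_diag0 diag1_step.
Qed.

(** The index of the image weakly decreases because [v] and [NN] both reverse order, and strictly
    because [NN] is injective; [decreasing_subn] then determines it. *)
Lemma NN_step (k : nat) : (k <= n)%N -> NN (v k) = v (n - k).
Proof.
have /boolp.choice [j jE] i :
    exists j : 'I_n.+1, (i <= n)%N -> NN (v i) = v j.
  case: (leqP i n) => [/NN_step_step [j jn e]|_]; last by exists ord0.
  by exists (Ordinal (jn : (j < n.+1)%N)) => _; rewrite e.
move=> kn; rewrite jE //; congr (v _).
apply: (decreasing_subn n j) kn => [i _|i ltin]; first by rewrite -ltnS.
have le_step : simplex_le (v i.+1) (v i).
  move=> l; rewrite !pi_step0 ltnS; case: (leqP l i) => [_|il]; first exact: i01_ge0.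
  by rewrite ltnNge (ltnW il).
have := NN_anti _ _ le_step; rewrite (jE i.+1) // (jE i) ?(ltnW ltin) //.
move/step_le => /(_ (ltn_ord (j i.+1))); rewrite leq_eqVlt.
case/orP => [/eqP e|//]; have : v i.+1 = v i.
  by rewrite -[LHS]NNK -[RHS]NNK (jE i.+1) // (jE i) ?(ltnW ltin) // e.
move/(congr1 (pi_ (Ordinal ltin))); rewrite !pi_step0 /= ltnSn ltnn.
by move/esym/i01_neq10.
Qed.

(** * Recovering the coordinates of an image *)

Lemma le_pi_NN (x : simplex R n) (i : 'I_n) (a : {i01 R}) :
  a <= pi_ i x <-> pi_ (rev_ord i) (NN x) <= diag_neg a.
Proof.
(* The meet is the least element with coordinate [i] at least [a]; the join is the greatest one with
   coordinate [rev_ord i], the last index below [n - i], at most [diag_neg a]. *)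
have NNe : NN (meet (v i) (diag n a)) = join (v (n - i)) (diag n (diag_neg a)).
  by rewrite NN_meet NN_step ?NN_diag // ltnW.
split=> [ax|xa].
  have ex : simplex_le (meet (v i) (diag n a)) x.
    move=> j; rewrite pi_meet pi_step0 pi_diag; case: ltnP => [_|ij].
      by rewrite ge_min i01_ge0.
    by rewrite ge_min (le_trans ax) ?orbT ?pi_mono.
  have := NN_anti _ _ ex (rev_ord i); rewrite NNe pi_join pi_step0 pi_diag /=.
  by rewrite subnSK // leqnn (max_r (i01_ge0 _)).
have : simplex_le (meet (v i) (diag n a)) x.
  apply: NN_le; rewrite NNe => j; rewrite pi_join pi_step0 pi_diag.
  case: ltnP => [ji|_]; last by rewrite le_max i01_le1.
  rewrite le_max (le_trans _ xa) ?orbT // pi_mono //=.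
  by rewrite -ltnS subnSK.
by move/(_ i); rewrite pi_meet pi_step0 pi_diag ltnn (min_r (i01_le1 _)).
Qed.

Lemma pi_NN (x : simplex R n) (i : 'I_n) :
  pi_ (rev_ord i) (NN x) = diag_neg (pi_ i x).
Proof.
have [[_ _ diag_neg_anti] diag_negK] := diag_neg_strong.
apply/le_anti; rewrite (proj1 (le_pi_NN x i _)) //=.
(* The reverse inequality uses [le_pi_NN] with [a] the [diag_neg] of the coordinate of [NN x]. *)
by rewrite -[leRHS]diag_negK diag_neg_anti //; apply/le_pi_NN; rewrite diag_negK.
Qed.

Lemma NN_tilde : NN = tilde (proj1 diag_neg_strong).
Proof.
apply/boolp.funext => x; apply: simplex_ext => i.
by rewrite pi_tilde -pi_NN rev_ordK.
Qed.

End StrongNegation.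

(** * The converse and the equivalence *)

Lemma tilde_strong {R : realType} {n : nat} (N : {i01 R} -> {i01 R})
    (hN : strong_fuzzy_negation N) :
  strong_nfuzzy_negation (tilde (n := n) (proj1 hN)).
Proof.
have [[N0 N1 N_anti] NK] := hN.
split; first split.
- by apply: simplex_ext => i; rewrite pi_tilde !pi_diag.
- by apply: simplex_ext => i; rewrite pi_tilde !pi_diag.
- by move=> x y xy i; rewrite !pi_tilde; apply: N_anti.
- by move=> x; apply: simplex_ext => i; rewrite !pi_tilde rev_ordK NK.
Qed.

Theorem theorem24 (R : realType) (n : nat) (hn : (1 <= n)%N)
    (NN : simplex R n -> simplex R n) :
  strong_nfuzzy_negation NN <->
  exists (N : {i01 R} -> {i01 R}) (hN : strong_fuzzy_negation N),
    NN = tilde (proj1 hN).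
Proof.
split=> [NN_strong|[N [hN ->]]]; last exact: tilde_strong.
case: n hn NN NN_strong => // m _ NN NN_strong.
by exists (diag_neg R m NN), (diag_neg_strong _ _ _ NN_strong); apply: NN_tilde.
Qed.
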